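(* Let $SG_n$ be the star graph on $n\ge3$ vertices, i.e. the undirected tree consisting of a center vertex $c$ adjacent to $n-1$ leaves, with all edges of the same weight $w>0$. Let $x,y$ be two distinct leaves. For $q>0$, $$U_q(c,x)=\frac{q(q+(n-1)w)}{(q+w)(q+nw)},\qquad U_q(x,y)=\frac{q\left(q^2+(n+2)wq+2(n-1)w^2\right)}{(q+w)^2(q+nw)},$$ and consequently $q\mapsto U_q(c,x)$ and $q\mapsto U_q(x,y)$ are strictly concave on $(0,\infty)$. Let $q_n=\bar q\,n^{\alpha}$ and take the edge weight of $SG_n$ to be $w_n=\bar w\,n^{\beta}$, with $\alpha,\beta\in\mathbb{R}$ and $\bar q,\bar w\in(0,\infty)$. Then $$\lim_{n\to\infty}U_{q_n}^{(SG_n)}(c,x)=\begin{cases}1&\alpha>\beta\\ \frac{\bar q}{\bar q+\bar w}&\alpha=\beta\\0&\alpha<\beta\end{cases}\qquad\text{and}\qquad\lim_{n\to\infty}U_{q_n}^{(SG_n)}(x,y)=\begin{cases}1&\alpha>\beta\\ \frac{\bar q(\bar q+2\bar w)}{(\bar q+\bar w)^2}&\alpha=\beta\\0&\alpha<\beta.\end{cases}$$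
   Context: An undirected weighted graph is considered as a directed graph in which each undirected edge gives two directed edges (one per orientation) of the same weight. A rooted spanning forest of a finite directed graph $G$ is a subset $F$ of its directed edges such that each vertex has at most one outgoing edge in $F$ and $F$ contains no directed cycle; its roots are the vertices without outgoing edge in $F$ and $r(F)$ is the number of roots. For $q>0$, the random rooted spanning forest $\Phi_q$ of $G$ has law $\mathbb{P}(\Phi_q=F)=q^{r(F)}w(F)/Z_G(q)$, where $w(F)=\prod_{e\in F}w(e)$ and $Z_G(q)=\sum_Fq^{r(F)}w(F)$ (sum over rooted spanning forests). $U_q(x,y)=U_q^{(G)}(x,y)$ is the probability that $x$ and $y$ belong to different trees (connected components, ignoring orientation) of $\Phi_q$. *)

(* Defs.v *)
From HB Require Import structures.
From mathcomp Require Import all_boot all_order all_algebra.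
From mathcomp Require Import all_classical all_reals all_analysis.

Set Implicit Arguments.
Unset Strict Implicit.
Unset Printing Implicit Defensive.

Import Order.TTheory GRing.Theory Num.Theory.
Import numFieldNormedType.Exports.

Local Open Scope ring_scope.

(* Only the weights of arcs belonging to [arcs] (resp. of edges belonging to
   [edges]) are meaningful. *)
Record wdigraph (R : Type) (V : finType) := WDigraph {
  arcs : {set V * V};
  arc_wt : V * V -> R
}.

Record wgraph (R : Type) (V : finType) := WGraph {
  edges : {set {set V}};
  edge_wt : {set V} -> R
}.

Definition bidirected (R : Type) (V : finType) (G : wgraph R V) :
    wdigraph R V :=
  WDigraph [set a : V * V | (a.1 != a.2) && ([set a.1; a.2] \in edges G)]
           (fun a => edge_wt G [set a.1; a.2]).

Section SpanningForests.
Variables (R : realType) (V : finType).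
Implicit Types (G : wdigraph R V) (F : {set V * V}) (q : R).

Definition out_arcs F (v : V) : {set V * V} := [set a in F | a.1 == v].

Definition arc_rel F : rel V := [rel u v | (u, v) \in F].

(* No arc of F is closed into a directed cycle by a directed path of F; see
   [acyclicP]. Loops are cycles. *)
Definition acyclic F : bool :=
  [forall a in F, ~~ connect (arc_rel F) a.2 a.1].

Lemma acyclicP F :
  reflect (forall c : seq V, cycle (arc_rel F) c -> c = [::]) (acyclic F).
Proof.
apply: (iffP forall_inP) => [acF [//|u p] /= | noc [u v] /= uvF].
- rewrite rcons_path => /andP[pth lst].
  have lF : (last u p, u) \in F by [].
  have /negP[] := acF _ lF.
  by apply/connectP; exists p.
- apply/negP => /connectP[p pth lst].
  have /noc // : cycle (arc_rel F) (v :: p).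
  by rewrite /= rcons_path pth /= -lst.
Qed.

Definition rooted_spanning_forest G F : bool :=
  [&& F \subset arcs G, [forall v, #|out_arcs F v| <= 1]%N & acyclic F].

Definition forest_roots F : {set V} := [set v | out_arcs F v == finset.set0].

Definition forest_wt G F : R := \prod_(a in F) arc_wt G a.

Definition partition_function G q : R :=
  \sum_(F | rooted_spanning_forest G F) q ^+ #|forest_roots F| * forest_wt G F.

(* Probability mass function of Phi_q. *)
Definition forest_law G q F : R :=
  if rooted_spanning_forest G F then
    q ^+ #|forest_roots F| * forest_wt G F / partition_function G q
  else 0.

Definition forest_prob G q (E : pred {set V * V}) : R :=
  \sum_(F | E F) forest_law G q F.

Definition same_tree F : rel V :=
  connect [rel u v | ((u, v) \in F) || ((v, u) \in F)].

Definition U G q (x y : V) : R := forest_prob G q (fun F => ~~ same_tree F x y).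

Lemma rooted_spanning_forest0 G : rooted_spanning_forest G finset.set0.
Proof.
apply/and3P; split; first exact: finset.sub0set.
- apply/forallP => v; rewrite (_ : out_arcs _ v = finset.set0) ?cards0 //.
  by apply/setP => a; rewrite !inE.
- by apply/forall_inP => a; rewrite inE.
Qed.

Lemma forest_wt_gt0 G F : {in arcs G, forall a, 0 < arc_wt G a} ->
  F \subset arcs G -> 0 < forest_wt G F.
Proof. by move=> w0 /fintype.subsetP sF; apply: prodr_gt0 => a /sF /w0. Qed.

Lemma partition_function_gt0 G q : {in arcs G, forall a, 0 < arc_wt G a} ->
  0 < q -> 0 < partition_function G q.
Proof.
move=> w0 q0; rewrite /partition_function (bigD1 finset.set0) /=; last first.
  exact: rooted_spanning_forest0.
have pos F : rooted_spanning_forest G F ->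
    0 < q ^+ #|forest_roots F| * forest_wt G F.
  by case/and3P => sF _ _; rewrite mulr_gt0 ?exprn_gt0 ?forest_wt_gt0.
apply: ltr_pwDl; first exact/pos/rooted_spanning_forest0.
by apply: sumr_ge0 => F /andP[/pos/ltW].
Qed.

Lemma forest_law_ge0 G q F : {in arcs G, forall a, 0 < arc_wt G a} ->
  0 < q -> 0 <= forest_law G q F.
Proof.
move=> w0 q0; rewrite /forest_law; case: ifP => // /and3P[sF _ _].
rewrite divr_ge0 ?(ltW (partition_function_gt0 _ _)) //.
by rewrite ltW // mulr_gt0 ?exprn_gt0 ?forest_wt_gt0.
Qed.

Lemma forest_prob_total G q : {in arcs G, forall a, 0 < arc_wt G a} ->
  0 < q -> forest_prob G q predT = 1.
Proof.
move=> w0 q0; rewrite /forest_prob /forest_law -big_mkcond -mulr_suml.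
by rewrite divff // gt_eqF // partition_function_gt0.
Qed.

End SpanningForests.

(* The vertex set is 'I_n and the center c is any of the n vertices. *)
Definition star (R : Type) (n : nat) (c : 'I_n) (w : R) : wgraph R 'I_n :=
  WGraph [set [set c; v] | v in [set v | v != c]] (fun=> w).

Definition star_digraph (R : Type) (n : nat) (c : 'I_n) (w : R) :
    wdigraph R 'I_n :=
  bidirected (star c w).

Definition strictly_concave_on (R : realType) (D : set R) (f : R -> R) : Prop :=
  forall x y t : R, D x -> D y -> x != y -> 0 < t < 1 ->
    t * f x + (1 - t) * f y < f (t * x + (1 - t) * y).

(* Main.v *)
Require Import Defs.
From HB Require Import structures.
From mathcomp Require Import all_boot all_order all_algebra.
From mathcomp Require Import all_classical all_reals all_analysis.
From mathcomp Require Import ring lra zify.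

Set Implicit Arguments.
Unset Strict Implicit.
Unset Printing Implicit Defensive.

Import Order.TTheory GRing.Theory Num.Theory.
Import numFieldNormedType.Exports.

Local Open Scope ring_scope.

(** Every arc of the star touches the center, so a rooted forest is determined by
    the set of leaves that point to the center together with the leaf, if any,
    that the center points to; the only constraint is that this leaf does not
    point back ([star_forest], [star_code]). For a set [A] of leaves, the total
    weight of the forests leaving all leaves of [A] isolated is then
    [q ^ (a+1) (q+w) ^ (n-a-1) (q + (n-a) w) / (q+w)] with [a = #|A|]
    ([sum_weight_detached]). For [A] empty this is the partition function. A leaf
    is in a different tree than the center iff it is isolated, and two leaves are
    in different trees iff at least one of them is isolated
    ([same_tree_joined]); the two closed forms follow, the second one by
    inclusion-exclusion ([U_center_leaf], [U_leaf_leaf]).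

    Strict concavity is read off expansions of the closed forms as [1] minus
    nonnegative combinations of [1 / (q + a)] and [1 / ((q + a)(q + b))], which
    are strictly convex on the positive half-line ([inv_strictly_convex],
    [invM_strictly_convex]).

    For the limits, put [s = q / (q + w)]. Up to the term [w / (q + n w)], which
    is at most [1 / n], the closed forms are [s] and [2 s - s ^ 2]
    ([cvg_U_star]). As [s] depends only on the ratio [w / q], a constant times
    [n ^ (beta - alpha)], its limit is found by comparing the exponents
    ([cvg_powR_fraction]). *)

(** * Rooted forests of the star *)

(** The binomial theorem read subset by subset: both sides expand the product
    over the elements of [C] of the choice between [w] (in [S]) and [q] (not
    in [S]). The factor attached to a point outside [C] is [0 + 1], which kills
    the subsets that are not contained in [C]. *)
Lemma sum_subset_binomial (R : comNzRingType) (T : finType) (C : {set T})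
    (q w : R) :
  \sum_(S : {set T} | S \subset C) w ^+ #|S| * q ^+ (#|C| - #|S|) =
    (q + w) ^+ #|C|.
Proof.
have -> : (q + w) ^+ #|C| =
    \prod_i ((if i \in C then w else 0) + (if i \in C then q else 1)).
  rewrite -prodr_const big_mkcond; apply: eq_bigr => i _.
  by case: ifP => _; rewrite ?add0r // addrC.
rewrite bigA_distr big_mkcond; apply: eq_bigr => J _.
case: ifPn => [JC | /fintype.subsetPn[i iJ /negbTE iC]]; last first.
  by rewrite (bigD1 i) //= iJ iC mul0r.
rewrite (bigID (fun i => i \in J)) /=; congr (_ * _).
  rewrite -prodr_const; apply: eq_bigr => i iJ.
  by rewrite iJ (fintype.subsetP JC).
rewrite -(finset.setIidPr JC) -cardsD -prodr_const.
rewrite big_mkcond [RHS]big_mkcond; apply: eq_bigr => i _.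
by rewrite !inE; case: (i \in J); case: (i \in C).
Qed.

Section StarForests.
Variables (R : realType) (n : nat) (c : 'I_n).
Implicit Types (F : {set 'I_n * 'I_n}) (A B S : {set 'I_n}) (q w : R).
Implicit Types (p : {set 'I_n} * 'I_n) (o u v : 'I_n).

Definition joined F v : bool := ((v, c) \in F) || ((c, v) \in F).

(** A rooted forest of the star is encoded by the set [p.1] of leaves pointing to
    the center and the target [p.2] of the arc leaving the center; the value
    [p.2 = c] stands for a center that is a root. *)
Definition star_forest p : {set 'I_n * 'I_n} :=
  [set a | (a.1 \in p.1) && (a.2 == c) ||
           [&& a.1 == c, a.2 == p.2 & p.2 != c]].

Definition star_code F : {set 'I_n} * 'I_n :=
  ([set v | (v, c) \in F], odflt c [pick v | (c, v) \in F]).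

(** The leaf chosen by the center must not point back to it: this is the only
    way a subset of arcs with out-degrees at most one can fail to be acyclic.
    The parameter [B] is the set of leaves that may touch the center. *)
Definition is_star_code B : pred ({set 'I_n} * 'I_n) :=
  fun p => (p.2 \in c |: B) && (p.1 \subset B :\ p.2).

Lemma mem_star_arcs w u v :
  ((u, v) \in arcs (star_digraph c w)) = (u != v) && ((u == c) || (v == c)).
Proof.
rewrite inE /=; case: eqVneq => //= uv.
apply/imsetP/orP => [[z _ euv] | [/eqP uc|/eqP vc]].
- have : c \in [set u; v] by rewrite euv set21.
  by rewrite !inE !(eq_sym c) => /orP.
- by exists v; rewrite ?inE -?uc // eq_sym.
- by exists u; rewrite ?inE -?vc // finset.setUC.
Qed.

Lemma star_forest_out p v u : p.1 \subset ~: [set c] ->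
  ((v, u) \in star_forest p) =
    if v == c then (u == p.2) && (p.2 != c) else (v \in p.1) && (u == c).
Proof.
move=> /fintype.subsetP sc; rewrite inE /=.
case: (eqVneq v c) => [->|vc] /=; last by rewrite orbF.
by case: (boolP (c \in p.1)) => // /sc; rewrite !inE eqxx.
Qed.

Lemma connect_sink (T : finType) (e : rel T) x y :
  (forall z, e x z = false) -> connect e x y -> y = x.
Proof. by move=> ex /connectP[[|z p] /=]; rewrite ?ex. Qed.

Lemma star_code_leaves B p : B \subset ~: [set c] -> is_star_code B p ->
  p.1 \subset ~: [set c].
Proof.
move=> sB /andP[_ sS].
by apply: fintype.subset_trans sB; apply: fintype.subset_trans sS (subsetDl _ _).
Qed.

(** The chosen leaf [p.2] has no outgoing arc, so every directed path has at most
    two steps and can only go from a leaf to the center and on to [p.2]. *)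
Lemma star_forest_rooted w B p : B \subset ~: [set c] -> is_star_code B p ->
  rooted_spanning_forest (star_digraph c w) (star_forest p).
Proof.
move=> sB pB; have sc := star_code_leaves sB pB.
have no v : v \in p.1 -> v != p.2.
  by case/andP: pB => _ /fintype.subsetP sS /sS; rewrite !inE => /andP[].
apply/and3P; split.
- apply/fintype.subsetP => -[u v]; rewrite mem_star_arcs star_forest_out //.
  case: eqVneq => [-> /andP[/eqP -> h]|uc /andP[_ /eqP ->]]; first by rewrite eq_sym h.
  by rewrite uc eqxx.
- apply/forallP => v; apply/card_le1_eqP => -[a1 a2] [b1 b2].
  move=> /setIdP[ha /eqP /= av] /setIdP[hb /eqP /= bv]; move: ha hb.
  rewrite {}av {}bv !star_forest_out //.
  case: ifP => _; first by move=> /andP[/eqP -> _] /andP[/eqP -> _].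
  by move=> /andP[_ /eqP ->] /andP[_ /eqP ->].
- apply/forall_inP => -[v u]; rewrite star_forest_out //=.
  have sink : p.2 != c -> forall z, arc_rel (star_forest p) p.2 z = false.
    move=> oc z; rewrite /arc_rel /= star_forest_out // (negbTE oc).
    by apply/negbTE/negP => /andP[/no]; rewrite eqxx.
  case: eqVneq => [-> /andP[/eqP -> oc] | vc /andP[vS /eqP ->]]; apply/negP.
    by move=> /(connect_sink (sink oc)) e; rewrite e eqxx in oc.
  case/connectP => -[/= _ vE|z r /= /andP[]]; first by rewrite vE eqxx in vc.
  rewrite {1}/arc_rel /= star_forest_out // eqxx => /andP[/eqP -> oc] pr lr.
  have /(connect_sink (sink oc)) vo : connect (arc_rel (star_forest p)) p.2 v.
    by apply/connectP; exists r.
  by have := no v vS; rewrite vo eqxx.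
Qed.

(** Out-degree at most one makes the arc leaving the center unique, hence
    recovered by [pick]; every other arc points to the center. *)
Lemma star_codeK w F : rooted_spanning_forest (star_digraph c w) F ->
  star_forest (star_code F) = F.
Proof.
move=> /and3P[/fintype.subsetP sF /forallP oF _].
have uF u v : (c, u) \in F -> (c, v) \in F -> u = v.
  move=> hu hv; have /card_le1_eqP := oF c => /(_ (c, u) (c, v)).
  by rewrite !inE hu hv !eqxx => /(_ isT isT) [->].
apply/setP => -[u v]; rewrite !inE /=.
have [->|vc] := eqVneq v c.
  rewrite andbT; case: pickP => [z zo /= | _ /=]; last by rewrite eqxx !andbF orbF.
  have := sF _ zo; rewrite mem_star_arcs => /andP[/negbTE ->].
  by rewrite andbF orbF.
rewrite andbF /=; case: pickP => [z zo /= | nc /=].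
  have := sF _ zo; rewrite mem_star_arcs eq_sym => /andP[oc _]; rewrite oc andbT.
  apply/andP/idP => [[/eqP -> /eqP ->] //|uv].
  have := sF _ uv; rewrite mem_star_arcs (negbTE vc) orbF => /andP[_ /eqP uc].
  by move: uv; rewrite uc eqxx => uv; rewrite (uF _ _ uv zo).
rewrite eqxx !andbF; apply/esym/negbTE/negP => uv.
have := sF _ uv; rewrite mem_star_arcs (negbTE vc) orbF => /andP[_ /eqP uc].
by move: uv; rewrite uc nc.
Qed.

Lemma star_forestK B p : B \subset ~: [set c] -> is_star_code B p ->
  star_code (star_forest p) = p.
Proof.
case: p => S o sB pB; have /andP[/= oB sS] := pB.
have sc := star_code_leaves sB pB.
congr pair.
  apply/setP => v; rewrite inE star_forest_out //= eqxx andbT.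
  case: (eqVneq v c) => [->|] //; rewrite eq_sym andbN.
  by apply/esym/negbTE/negP => /(fintype.subsetP sc); rewrite !inE eqxx.
case: pickP => [u|] /=; first by rewrite star_forest_out //= eqxx => /andP[/eqP].
by move=> /(_ o); rewrite star_forest_out //= !eqxx /=; case: eqVneq.
Qed.

Definition detached A F := [forall v in A, ~~ joined F v].

(** A leaf both pointing to the center and chosen by it would close a cycle of
    length two, so acyclicity separates the two components of the code. *)
Lemma star_code_detached w A F :
  rooted_spanning_forest (star_digraph c w) F -> detached A F ->
  is_star_code (~: (c |: A)) (star_code F).
Proof.
move=> /and3P[/fintype.subsetP sF _ /forall_inP aF] /forall_inP dA.
have noloop u v : (u, v) \in F -> u != v.
  by move=> /sF; rewrite mem_star_arcs => /andP[].
have oF : (star_code F).2 != c -> (c, (star_code F).2) \in F.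
  by rewrite /star_code /=; case: pickP => //=; rewrite eqxx.
have SE v : (v \in (star_code F).1) = ((v, c) \in F) by rewrite inE.
case: (star_code F) SE oF => S o /= SE oF; apply/andP; split => /=.
  have [->|/oF co] := eqVneq o c; first exact: setU11.
  rewrite !inE eq_sym (negbTE (noloop _ _ co)) /=.
  by apply/negP => /dA; rewrite /joined co orbT.
apply/fintype.subsetP => v; rewrite SE !inE => vF.
rewrite (negbTE (noloop _ _ vF)) /= andbC.
apply/andP; split; first by apply/negP => /dA; rewrite /joined vF.
apply/eqP => vo; have /oF co : o != c by rewrite -vo (noloop _ _ vF).
have /negP[] := aF _ co.
by apply: connect1 => /=; rewrite -vo.
Qed.

(** In this form the equivalence is the side condition needed to reindex a sum
    over forests by codes. *)
Lemma star_forest_detachedE w A p : A \subset ~: [set c] ->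
  [&& rooted_spanning_forest (star_digraph c w) (star_forest p),
      detached A (star_forest p) & star_code (star_forest p) == p] =
  is_star_code (~: (c |: A)) p.
Proof.
move=> sA; have sB : ~: (c |: A) \subset ~: [set c].
  by rewrite finset.setCS finset.subsetUl.
apply/and3P/idP => [[rF dA /eqP <-]|pB]; first exact: star_code_detached rF dA.
split; [exact: star_forest_rooted sB pB | | by rewrite (star_forestK sB pB)].
apply/forall_inP => v vA.
have /[!inE] vc := fintype.subsetP sA v vA.
case: p pB => S o pB; have /andP[/= oB sS] := pB.
have sc := star_code_leaves sB pB.
rewrite /joined !star_forest_out //= (negbTE vc) !eqxx andbT negb_or; apply/andP; split.
  by apply/negP => /(fintype.subsetP sS); rewrite !inE vA orbT andbF.
apply/negP => /andP[/eqP vo oc].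
by move: oB; rewrite -vo !inE vA orbT orbF (negbTE vc).
Qed.

Definition weight w q F : R :=
  q ^+ #|forest_roots F| * forest_wt (star_digraph c w) F.

(** A forest is indexed by its non-root vertices: each of them, here the elements
    of [T], carries exactly one arc. So it has [#|T|] arcs and [n - #|T|]
    roots. *)
Lemma weight_star_forest w q B p : B \subset ~: [set c] -> is_star_code B p ->
  weight w q (star_forest p) =
  q ^+ (n - (#|p.1| + (p.2 != c))) * w ^+ (#|p.1| + (p.2 != c)).
Proof.
case: p => S o sB pB; have /andP[/= oB sS] := pB.
have sc := star_code_leaves sB pB.
have cS : c \notin S by apply/negP => /(fintype.subsetP sc); rewrite !inE eqxx.
pose T := if o == c then S else c |: S.
have cT : #|T| = (#|S| + (o != c))%N.
  by rewrite /T; case: eqVneq; rewrite ?addn0 // cardsU1 cS addnC.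
have FT : star_forest (S, o) = [set (v, if v == c then o else c) | v in T].
  apply/setP => -[v u]; rewrite star_forest_out //=.
  apply/idP/imsetP => [|[z zT [-> ->]]].
    case: eqVneq => [-> /andP[/eqP -> oc]|vc /andP[vS /eqP ->]].
      by exists c; rewrite ?eqxx // /T (negbTE oc) setU11.
    exists v; rewrite ?(negbTE vc) // /T; case: ifP => // _.
    by rewrite inE vS orbT.
  move: zT; rewrite /T; case: (eqVneq o c) => [->|oc].
    by case: eqVneq => [->|_ ->]; rewrite ?(negbTE cS) // eqxx.
  by rewrite !inE; case: (eqVneq z c) => _ /=; rewrite eqxx ?andbT.
rewrite /weight /forest_wt.
have -> : forest_roots (star_forest (S, o)) = ~: T.
  apply/setP => v; rewrite !inE FT; apply/eqP/negP => [e vT|vT].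
    have : (v, if v == c then o else c) \in out_arcs (star_forest (S, o)) v.
      by rewrite inE eqxx andbT FT; apply/imsetP; exists v.
    by rewrite FT e inE.
  apply/setP => a; rewrite !inE; apply/negbTE/negP => /andP[/imsetP[z zT ->]].
  by move=> /eqP /= zv; rewrite -zv in vT.
rewrite cardsCs finset.setCK card_ord cT; congr (_ * _).
rewrite prodr_const /= FT card_imset ?cT // => u v [] //.
Qed.

(** The leaves of [A] are isolated roots and contribute [q ^+ #|A|]. Each of the
    [b = n - 1 - #|A|] other leaves freely points to the center or is a root, a
    factor [q + w]. If the center is a root this gives [q * (q + w) ^+ b]; if it
    points to one of the [b] leaves, that leaf is a root, which gives
    [b * w * q * (q + w) ^+ (b - 1)]. Dividing by [q + w] makes the formula
    cover [b = 0] as well. *)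
Lemma sum_weight_detached w q A : A \subset ~: [set c] -> q + w != 0 ->
  \sum_(F | rooted_spanning_forest (star_digraph c w) F && detached A F)
    weight w q F =
  q ^+ #|A|.+1 * (q + w) ^+ (n - #|A|.+1) * (q + (n - #|A|)%:R * w) / (q + w).
Proof.
move=> sA qw0.
have sB : ~: (c |: A) \subset ~: [set c] by rewrite finset.setCS finset.subsetUl.
have cA : c \notin A by apply/negP => /(fintype.subsetP sA); rewrite !inE eqxx.
have cU : #|c |: A| = #|A|.+1 by rewrite cardsU1 cA.
have An : (#|A| < n)%N by rewrite -cU -[X in (_ <= X)%N]card_ord max_card.
rewrite (reindex_onto star_forest star_code); last first.
  by move=> F /andP[/star_codeK].
rewrite (eq_bigl (is_star_code (~: (c |: A)))) => [|p]; last first.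
  by rewrite -andbA star_forest_detachedE.
rewrite (eq_bigr _ (fun p => @weight_star_forest w q _ p sB)).
set B := ~: (c |: A) in sB *.
have cB : #|B| = (n - #|A|.+1)%N by rewrite cardsCs finset.setCK card_ord cU.
have cNB : c \notin B by rewrite !inE eqxx.
(* Fix the arc leaving the center first; the leaves are then independent. *)
transitivity (\sum_(o in c |: B) \sum_(S : {set 'I_n} | S \subset B :\ o)
   q ^+ (n - (#|S| + (o != c))) * w ^+ (#|S| + (o != c))).
  rewrite [RHS](exchange_big_dep predT) //= pair_big_dep /=.
  by apply: eq_bigl => p; rewrite /is_star_code.
have sumo o : \sum_(S : {set 'I_n} | S \subset B :\ o)
   q ^+ (n - (#|S| + (o != c))) * w ^+ (#|S| + (o != c)) =
   q ^+ (n - #|B :\ o| - (o != c)) * w ^+ (o != c) * (q + w) ^+ #|B :\ o|.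
  rewrite -sum_subset_binomial mulr_sumr; apply: eq_bigr => S sS.
  have := subset_leq_card sS => SB.
  have Bn : (#|B :\ o| < n)%N.
    have := max_card (o |: B :\ o); rewrite card_ord.
    by rewrite cardsU1 !inE eqxx.
  have := leq_b1 (o != c) => oc1.
  rewrite [w ^+ _ * q ^+ _]mulrC mulrACA -!exprD [(_ + #|S|)%N]addnC.
  have arith (a b s e : nat) : (s <= b -> b < a -> e <= 1 ->
      a - (s + e) = a - b - e + (b - s))%N by lia.
  by rewrite (arith _ _ _ _ SB Bn oc1).
rewrite (eq_bigr _ (fun o _ => sumo o)) big_setU1 //= eqxx expr0 mulr1 subn0.
rewrite (finset.setDidPl _); last by rewrite disjoint_sym disjoints1.
rewrite (eq_bigr (fun _ => q ^+ (#|A|.+1) * w * (q + w) ^+ #|B|.-1)) => [|o oB].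
  have -> : (n - #|B|)%N = #|A|.+1 by rewrite cB; lia.
  have -> : (n - #|A|)%N = #|B|.+1 by rewrite cB; lia.
  rewrite sumr_const -cB; case: #|B| => [|k] /=.
    by rewrite mulr0n addr0 expr0 mulr1 mul1r mulfK.
  rewrite -mulr_natl -[k.+2%:R]natr1 [(q + w) ^+ k.+1]exprS.
  by field.
have : #|B| = #|B :\ o|.+1 by rewrite (cardsD1 o) oB.
have -> : o != c by apply: contraNneq cNB => <-.
move=> Bo; rewrite Bo /= expr1; congr (q ^+ _ * _ * _).
have arith (a b : nat) : (a < n -> b.+1 = n - a.+1 -> n - b - 1 = a.+1)%N by lia.
by apply: arith An _; rewrite -Bo.
Qed.

Lemma same_treeC F u v : same_tree F u v = same_tree F v u.
Proof. by apply: sym_connect_sym => a b; rewrite /= orbC. Qed.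

Lemma forest_center w F : rooted_spanning_forest (star_digraph c w) F ->
  forall u v, (u, v) \in F -> (u == c) || (v == c).
Proof.
by case/and3P => /fintype.subsetP sF _ _ u v /sF; rewrite mem_star_arcs => /andP[].
Qed.

(** In a star every path between two vertices passes through the center, so a
    leaf that is not joined to the center is alone in its tree. *)
Lemma same_tree_joined F x y : (forall u v, (u, v) \in F -> (u == c) || (v == c)) ->
  x != y -> x != c ->
  same_tree F x y = joined F x && ((y == c) || joined F y).
Proof.
move=> cF xy xc; rewrite /same_tree; set e := (X in connect X).
have ec u : u != c -> forall v, e u v = joined F u && (v == c).
  move=> uc v; rewrite /e /joined /=; have [->|vc] := eqVneq v c; first by rewrite andbT.
  rewrite andbF; apply/negbTE; rewrite negb_or; apply/andP; split;
  by apply/negP => /cF; rewrite (negbTE uc) (negbTE vc).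
have es : connect_sym e := same_treeC F.
have isolated u z : u != c -> ~~ joined F u -> connect e u z -> z = u.
  by move=> uc /negbTE ju; apply: connect_sink => v; rewrite ec // ju.
have jc u : u != c -> joined F u -> connect e u c.
  by move=> uc ju; apply: connect1; rewrite ec // ju eqxx.
apply/idP/andP => [cxy|[jx jy]].
  split.
    apply: contraT => /(isolated _ _ xc) /(_ cxy) yx; by rewrite yx eqxx in xy.
  have [//|yc /=] := eqVneq y c.
  apply: contraT => /(isolated _ x yc); rewrite es => /(_ cxy) yx.
  by rewrite yx eqxx in xy.
apply: connect_trans (jc _ xc jx) _; have [->//|yc] := eqVneq y c.
by rewrite es jc //; move: jy; rewrite (negbTE yc).
Qed.

Lemma partition_function_star w q : q + w != 0 ->
  partition_function (star_digraph c w) q =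
  q * (q + w) ^+ n.-1 * (q + n%:R * w) / (q + w).
Proof.
move=> qw0; have := sum_weight_detached (finset.sub0set _) qw0.
rewrite cards0 expr1 subn1 subn0 => <-.
apply: eq_bigl => F; rewrite (_ : detached _ _) ?andbT //.
by apply/forall_inP => v; rewrite inE.
Qed.

Lemma star_prob w q (E : pred {set 'I_n * 'I_n}) :
  forest_prob (star_digraph c w) q E =
  (\sum_(F | rooted_spanning_forest (star_digraph c w) F && E F) weight w q F) /
    partition_function (star_digraph c w) q.
Proof.
rewrite /forest_prob /forest_law mulr_suml -big_mkcondr.
by apply: eq_bigl => F; rewrite andbC.
Qed.

End StarForests.

(** * Closed forms *)

Section ClosedForms.
Variables (R : realType) (n : nat) (w : R) (c x y : 'I_n).

(** The leaf is separated from the center exactly when it is isolated. *)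
Lemma U_center_leaf (q : R) : 0 < w -> 0 < q -> x != c ->
  U (star_digraph c w) q c x =
    q * (q + (n%:R - 1) * w) / ((q + w) * (q + n%:R * w)).
Proof.
move=> w0 q0 xc.
have qw0 : q + w != 0 by rewrite lt0r_neq0 ?addr_gt0.
have n1 : (1 < n)%N.
  have := max_card [set c; x]; rewrite card_ord cards2 eq_sym xc; exact: id.
have qnw : q + n%:R * w != 0.
  by rewrite lt0r_neq0 // addr_gt0 ?mulr_gt0 ?ltr0n ?(ltn_trans _ n1).
rewrite /U star_prob partition_function_star //.
have sx : [set x] \subset ~: [set c] by rewrite finset.sub1set !inE.
have := sum_weight_detached sx qw0; rewrite cards1 => E.
rewrite (eq_bigl (fun F => rooted_spanning_forest (star_digraph c w) F &&
   detached c [set x] F)) => [|F]; last first.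
  case: (boolP (rooted_spanning_forest _ F)) => //= /forest_center cF.
  rewrite same_treeC (same_tree_joined cF xc xc) eqxx andbT.
  by apply/idP/forall_inP => [jx v /set1P -> //|]; apply; rewrite set11.
rewrite {}E.
have -> : n.-1 = (n - 2).+1 by rewrite -subn1; lia.
rewrite natrB ?(ltnW n1) // [(q + w) ^+ (n - 2).+1]exprS.
by field; rewrite qw0 qnw expf_neq0 // lt0r_neq0.
Qed.

(** Two leaves are separated exactly when one of them is isolated, so the
    probability follows from [sum_weight_detached] by inclusion-exclusion. *)
Lemma U_leaf_leaf (q : R) : 0 < w -> 0 < q -> x != c -> y != c -> x != y ->
  U (star_digraph c w) q x y =
    q * (q ^+ 2 + (n%:R + 2) * w * q + 2 * (n%:R - 1) * w ^+ 2)
      / ((q + w) ^+ 2 * (q + n%:R * w)).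
Proof.
move=> w0 q0 xc yc xy.
have qw0 : q + w != 0 by rewrite lt0r_neq0 ?addr_gt0.
have n2 : (2 < n)%N.
  have := max_card (c |: [set x; y]); rewrite card_ord cardsU1 cards2 xy.
  by rewrite !inE eq_sym (negbTE xc) eq_sym (negbTE yc).
have qnw : q + n%:R * w != 0.
  by rewrite lt0r_neq0 // addr_gt0 ?mulr_gt0 ?ltr0n ?(ltn_trans _ n2).
rewrite /U star_prob partition_function_star //.
set forest := rooted_spanning_forest (star_digraph c w).
have sum1 u : u != c ->
    \sum_(F | forest F && ~~ joined c F u) weight c w q F =
    q ^+ 2 * (q + w) ^+ (n - 2) * (q + (n%:R - 1) * w) / (q + w).
  move=> uc; have su : [set u] \subset ~: [set c] by rewrite finset.sub1set !inE.
  have := sum_weight_detached su qw0; rewrite cards1 natrB ?(ltn_trans _ n2) // => <-.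
  apply: eq_bigl => F; congr andb.
  by apply/idP/forall_inP => [ju v /set1P -> //|]; apply; rewrite set11.
have sum2 : \sum_(F | forest F && (~~ joined c F x && ~~ joined c F y)) weight c w q F =
    q ^+ 3 * (q + w) ^+ (n - 3) * (q + (n%:R - 2) * w) / (q + w).
  have sxy : [set x; y] \subset ~: [set c].
    by apply/fintype.subsetP => v /set2P[] ->; rewrite !inE.
  have := sum_weight_detached sxy qw0; rewrite cards2 xy natrB ?(ltnW n2) // => <-.
  apply: eq_bigl => F; congr andb.
  apply/andP/forall_inP => [[jx jy] v /set2P[] -> //|j].
  by rewrite !j ?set21 ?set22.
(* Inclusion-exclusion, checked forest by forest. *)
have -> : \sum_(F | forest F && ~~ same_tree F x y) weight c w q F =
    \sum_(F | forest F && ~~ joined c F x) weight c w q F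
    + \sum_(F | forest F && ~~ joined c F y) weight c w q F
    - \sum_(F | forest F && (~~ joined c F x && ~~ joined c F y)) weight c w q F.
  rewrite big_mkcond [X in _ = X + _ - _]big_mkcond [X in _ = _ + X - _]big_mkcond.
  rewrite [X in _ = _ - X]big_mkcond -big_split -sumrB; apply: eq_bigr => F _.
  case: (boolP (forest F)) => [/forest_center cF|_] /=; last by rewrite addr0 subr0.
  rewrite (same_tree_joined cF xy xc) (negbTE yc) /=.
  by case: (joined c F x); case: (joined c F y) => /=;
    rewrite ?subr0 ?addrK ?addr0 ?add0r.
rewrite !sum1 // sum2.
have -> : n.-1 = (n - 3).+2 by rewrite -subn1; lia.
have -> : (n - 2)%N = (n - 3).+1 by lia.
rewrite ![(q + w) ^+ _.+1]exprS.
by field; rewrite qw0 qnw expf_neq0 // lt0r_neq0.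
Qed.

End ClosedForms.

(** * Strict concavity *)

Local Open Scope classical_set_scope.

(** With [m = t * p + (1 - t) * q], the convexity gap is
    [t * (1 - t) * (p - q) ^+ 2 / ((p + a) * (q + a) * (m + a))]. *)
Lemma inv_strictly_convex (R : realType) (a : R) : 0 <= a ->
  strictly_concave_on `]0, +oo[ (fun q => - (q + a)^-1).
Proof.
move=> a0 p q t /=; rewrite !in_itv /= !andbT => p0 q0 pq /andP[t0 t1].
have P0 : 0 < p + a by rewrite ltr_wpDr.
have Q0 : 0 < q + a by rewrite ltr_wpDr.
have s0 : 0 < 1 - t by rewrite subr_gt0.
have M0 : 0 < t * p + (1 - t) * q + a.
  by rewrite ltr_wpDr // addr_gt0 ?mulr_gt0.
rewrite -subr_gt0.
have -> : - (t * p + (1 - t) * q + a)^-1 - (t * - (p + a)^-1 + (1 - t) * - (q + a)^-1)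
   = t * (1 - t) * (p - q) ^+ 2 / ((p + a) * (q + a) * (t * p + (1 - t) * q + a)).
  by field; rewrite !lt0r_neq0.
have pq0 : 0 < (p - q) ^+ 2 by rewrite exprn_even_gt0 // subr_eq0.
by rewrite divr_gt0 // mulr_gt0 // mulr_gt0.
Qed.

(** A product of two positive decreasing convex functions is convex: the product
    of the two chords lies below the chord of the product by
    [t * (1 - t) * (f p - f q) * (g p - g q)], which is nonnegative because [f]
    and [g] vary in the same direction. *)
Lemma invM_strictly_convex (R : realType) (a b : R) : 0 <= a -> 0 <= b ->
  strictly_concave_on `]0, +oo[ (fun q => - ((q + a) * (q + b))^-1).
Proof.
move=> a0 b0 p q t Dp Dq pq t01.
have := inv_strictly_convex b0 Dp Dq pq t01.
have := inv_strictly_convex a0 Dp Dq pq t01.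
move: Dp Dq t01; rewrite /= !in_itv /= !andbT => p0 q0 /andP[t0 t1].
have s0 : 0 < 1 - t by rewrite subr_gt0.
have m0 : 0 < t * p + (1 - t) * q by rewrite addr_gt0 ?mulr_gt0.
rewrite !mulrN -!opprD !ltrN2 => ha hb.
rewrite !invfM; set m := t * p + _ in m0 ha hb *.
have iv u (z : R) : 0 < u -> 0 <= z -> 0 < (u + z)^-1.
  by move=> u0 z0; rewrite invr_gt0 ltr_wpDr.
apply: (@lt_le_trans _ _ ((t / (p + a) + (1 - t) / (q + a)) *
    (t / (p + b) + (1 - t) / (q + b)))).
  by rewrite ltr_pM // ltW // iv.
rewrite -subr_ge0.
have -> : t * ((p + a)^-1 / (p + b)) + (1 - t) * ((q + a)^-1 / (q + b)) -
  (t / (p + a) + (1 - t) / (q + a)) * (t / (p + b) + (1 - t) / (q + b)) =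
  t * (1 - t) * (((p + a)^-1 - (q + a)^-1) * ((p + b)^-1 - (q + b)^-1)) by ring.
rewrite mulr_ge0 //; first by rewrite mulr_ge0 ?ltW.
have dec (z : R) : 0 <= z -> (p + z)^-1 - (q + z)^-1 =
    (q - p) * ((p + z)^-1 * (q + z)^-1).
  by move=> z0; field; rewrite !lt0r_neq0 ?ltr_wpDr.
rewrite !dec // mulrACA -expr2 mulr_ge0 ?sqr_ge0 //.
by rewrite !mulr_ge0 ?ltW ?iv.
Qed.

(** Strictness comes from the positive coefficient [a] alone; [b] may vanish. *)
Lemma strictly_concave_combination (R : realType) (D : set R) (f g : R -> R) (d a b : R) :
  strictly_concave_on D (fun q => - f q) -> strictly_concave_on D (fun q => - g q) ->
  0 < a -> 0 <= b ->
  strictly_concave_on D (fun q => d - a * f q - b * g q).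
Proof.
move=> cf cg a0 b0 p q t Dp Dq pq t01.
have := cf p q t Dp Dq pq t01; have /ltW := cg p q t Dp Dq pq t01.
rewrite -(ltr_pM2l a0) => /(ler_wpM2l b0); lra.
Qed.

Lemma eq_strictly_concave_on_pos (R : realType) (f g : R -> R) :
  (forall q, 0 < q -> f q = g q) ->
  strictly_concave_on `]0, +oo[ f -> strictly_concave_on `]0, +oo[ g.
Proof.
move=> fg cf p q t Dp Dq pq t01; have := cf p q t Dp Dq pq t01.
move: Dp Dq t01; rewrite /= !in_itv /= !andbT => p0 q0 /andP[t0 t1].
by rewrite !fg // addr_gt0 ?mulr_gt0 // subr_gt0.
Qed.

Section Concavity.
Variables (R : realType) (n : nat) (w : R) (c x y : 'I_n).

(** Partial fractions with two positive coefficients: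
    [U = 1 - w (n-2)/(n-1) / (q+w) - n w/(n-1) / (q + n w)]. *)
Lemma U_center_leaf_concave : (2 < n)%N -> 0 < w -> x != c ->
  strictly_concave_on `]0, +oo[ (fun q => U (star_digraph c w) q c x).
Proof.
move=> n2 w0 xc.
have n2R : 2 < n%:R :> R by rewrite (ltr_nat _ 2).
have n1 : 0 < n%:R - 1 :> R by lra.
have nw0 : 0 < n%:R * w by rewrite mulr_gt0 //; lra.
have ca := @strictly_concave_combination R _ _ _ 1
  (w * (n%:R - 2) / (n%:R - 1)) (n%:R * w / (n%:R - 1))
  (inv_strictly_convex (ltW w0)) (inv_strictly_convex (ltW nw0)).
apply: eq_strictly_concave_on_pos (ca _ _) => [q q0||].
- rewrite U_center_leaf //; field.
  by rewrite (lt0r_neq0 n1) !lt0r_neq0 ?addr_gt0.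
- by rewrite divr_gt0 ?mulr_gt0 //; lra.
- by rewrite divr_ge0 ?ltW //; lra.
Qed.

(** The plain partial fraction expansion has coefficients of both signs.
    Grouping the two simple poles into one product restores the sign:
    [U = 1 - 2 n w^2/(n-1) / ((q+w)(q + n w)) - w^2 (n-3)/(n-1) / (q+w)^2].
    The last coefficient vanishes for [n = 3]. *)
Lemma U_leaf_leaf_concave : (2 < n)%N -> 0 < w -> x != c -> y != c -> x != y ->
  strictly_concave_on `]0, +oo[ (fun q => U (star_digraph c w) q x y).
Proof.
move=> n2 w0 xc yc xy.
have n3R : 3 <= n%:R :> R by rewrite (ler_nat _ 3).
have n1 : 0 < n%:R - 1 :> R by lra.
have nw0 : 0 < n%:R * w by rewrite mulr_gt0 //; lra.
have ca := @strictly_concave_combination R _ _ _ 1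
  (2 * n%:R * w ^+ 2 / (n%:R - 1)) (w ^+ 2 * (n%:R - 3) / (n%:R - 1))
  (invM_strictly_convex (ltW w0) (ltW nw0)) (invM_strictly_convex (ltW w0) (ltW w0)).
apply: eq_strictly_concave_on_pos (ca _ _) => [q q0||].
- rewrite U_leaf_leaf //; field.
  by rewrite (lt0r_neq0 n1) !lt0r_neq0 ?addr_gt0.
- by rewrite divr_gt0 ?mulr_gt0 ?exprn_gt0 //; lra.
- by rewrite divr_ge0 ?mulr_ge0 ?exprn_ge0 //; lra.
Qed.

End Concavity.

(** * Limits *)

Section Limits.
Variable R : realType.

Lemma cvg_invS3 : (k.+3%:R : R)^-1 @[k --> \oo] --> 0.
Proof.
have := @cvg_harmonic R; rewrite -cvg_shiftS -cvg_shiftS; exact: id.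
Qed.

Lemma cvg_powR_neg (e : R) : e < 0 -> k.+3%:R `^ e @[k --> \oo] --> 0.
Proof.
move=> e0.
have invp : (k.+3%:R : R)^-1 @[k --> \oo] --> 0^'+.
  move=> P /cvg_invS3 pP.
  have {}pP : \forall k \near \oo, 0 < (k.+3%:R : R)^-1 -> P (k.+3%:R : R)^-1 by [].
  rewrite /= nbhs_simpl /=; apply: filterS pP => k /=; apply.
  by rewrite invr_gt0 ltr0n.
have /(cvg_comp _ _ invp) : u `^ (- e) @[u --> 0^'+] --> (0 : R).
  by apply: powR_cvg0; rewrite oppr_gt0.
rewrite (_ : _ \o _ = fun k => k.+3%:R `^ e) //.
by apply/funext => k /=; rewrite -powR_inv1 // -powRrM mulN1r opprK.
Qed.

Lemma cvg_weighted_fraction (a b l m : R) (u v : nat -> R) :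
  u k @[k --> \oo] --> l -> v k @[k --> \oo] --> m -> a * l + b * m != 0 ->
  a * u k / (a * u k + b * v k) @[k --> \oo] --> a * l / (a * l + b * m).
Proof.
move=> ul vm d0.
apply: cvgM; first by apply: cvgM => //; exact: cvg_cst.
apply: cvgV => //.
by apply: cvgD; apply: cvgM => //; exact: cvg_cst.
Qed.

(** Dividing numerator and denominator by the dominant power leaves a negative
    power, which tends to zero. *)
Lemma cvg_powR_fraction (alpha beta a b : R) : 0 < a -> 0 < b ->
  a * k.+3%:R `^ alpha / (a * k.+3%:R `^ alpha + b * k.+3%:R `^ beta) @[k --> \oo]
    --> (if beta < alpha then 1 else if alpha == beta then a / (a + b) else 0 : R).
Proof.
move=> a0 b0.
have p0 e (k : nat) : 0 < k.+3%:R `^ e :> R by rewrite powR_gt0.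
(* Factors out the dominant power, so that only the exponent difference is left. *)
have pB (k : nat) e f : k.+3%:R `^ e = k.+3%:R `^ (e - f) * k.+3%:R `^ f :> R.
  by rewrite -powRD ?subrK // pnatr_eq0 implybT.
have -> : (fun k : nat => a * k.+3%:R `^ alpha /
    (a * k.+3%:R `^ alpha + b * k.+3%:R `^ beta)) =
  if beta < alpha then fun k : nat => a * 1 / (a * 1 + b * k.+3%:R `^ (beta - alpha))
  else fun k : nat => a * k.+3%:R `^ (alpha - beta) /
    (a * k.+3%:R `^ (alpha - beta) + b * 1).
  apply/funext => k; case: ifP => _.
    rewrite (pB k beta alpha); field.
    by rewrite !lt0r_neq0 ?addr_gt0 // ?mulr_gt0 // mulr_gt0.
  rewrite (pB k alpha beta); field.
  by rewrite !lt0r_neq0 ?addr_gt0 // ?mulr_gt0 // mulr_gt0.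
have cvg1 : (fun=> 1 : R) k @[k --> \oo] --> (1 : R) by exact: cvg_cst.
have [ba|ab|->] := ltgtP beta alpha.
- rewrite -subr_lt0 in ba.
  have := cvg_weighted_fraction (a := a) (b := b) cvg1 (cvg_powR_neg ba).
  by rewrite mulr0 addr0 mulr1 divff ?lt0r_neq0 //; apply.
- rewrite -subr_lt0 in ab.
  have := cvg_weighted_fraction (a := a) (b := b) (cvg_powR_neg ab) cvg1.
  by rewrite mulr0 add0r mulr1 mul0r; apply; exact: lt0r_neq0.
- under eq_fun do rewrite subrr powRr0 !mulr1.
  exact: cvg_cst.
Qed.

(** The quotient lies between [0] and [1 / n], whatever the sequences. *)
Lemma cvg_remainder (q w : nat -> R) : (forall k, 0 < q k) -> (forall k, 0 < w k) ->
  w k / (q k + k.+3%:R * w k) @[k --> \oo] --> 0.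
Proof.
move=> q0 w0; apply: (squeeze_cvgr _ (cvg_cst 0) cvg_invS3).
apply: nearW => k.
have d0 : 0 < k.+3%:R * w k by rewrite mulr_gt0.
apply/andP; split; first by rewrite divr_ge0 ?addr_ge0 ?ltW.
rewrite ler_pdivrMr ?addr_gt0 //.
by rewrite mulrDr mulKf ?pnatr_eq0 // lerDr mulr_ge0 ?invr_ge0 ?ler0n // ltW.
Qed.

(** With [s = q / (q + w)] and the vanishing term [e = w / (q + n w)], the closed
    forms read [s * (1 - e)] for a center and a leaf, and
    [2 * s * (1 - e) - s ^+ 2 * (1 - 2 * e)] for two leaves. So the limit of [s]
    governs both: asymptotically a leaf is isolated with probability [s], and
    two leaves are isolated independently. *)
Lemma cvg_U_star (alpha beta qbar wbar : R) (c x y : forall k : nat, 'I_k.+3) :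
  0 < qbar -> 0 < wbar ->
  (forall k : nat, [/\ x k != c k, y k != c k & x k != y k]) ->
  let q (k : nat) : R := qbar * k.+3%:R `^ alpha in
  let w (k : nat) : R := wbar * k.+3%:R `^ beta in
  forall s : R, q k / (q k + w k) @[k --> \oo] --> s ->
  (U (star_digraph (c k) (w k)) (q k) (c k) (x k) @[k --> \oo] --> s) /\
  (U (star_digraph (c k) (w k)) (q k) (x k) (y k) @[k --> \oo] --> 2 * s - s ^+ 2).
Proof.
move=> qb wb xyc q w s qs.
have q0 k : 0 < q k by rewrite mulr_gt0 ?powR_gt0.
have w0 k : 0 < w k by rewrite mulr_gt0 ?powR_gt0.
have es := cvg_remainder q0 w0.
have d1 k : q k + w k != 0 by rewrite lt0r_neq0 ?addr_gt0.
have d2 k : q k + k.+3%:R * w k != 0 by rewrite lt0r_neq0 // addr_gt0 // mulr_gt0.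
set e := (fun k => _) in es.
have e1 : 1 - e k @[k --> \oo] --> (1 : R).
  by rewrite -[X in _ --> X]subr0; apply: cvgB => //; exact: cvg_cst.
have e2 : 1 - 2 * e k @[k --> \oo] --> (1 : R).
  rewrite -[X in _ --> X]subr0 -(mulr0 2).
  by apply: cvgB; [|apply: cvgM => //]; exact: cvg_cst.
split.
- rewrite (_ : (fun k => U _ _ _ _) = fun k => q k / (q k + w k) * (1 - e k)).
    by rewrite -[X in _ --> X]mulr1; exact: cvgM.
  apply/funext => k; have [xc _ _] := xyc k; rewrite U_center_leaf // /e.
  move: (d1 k) (d2 k); move: (q k) (w k) (k.+3%:R : R) => Q W N h1 h2.
  by field; rewrite h1 h2.
- rewrite (_ : (fun k => U _ _ _ _) = fun k => 2 * (q k / (q k + w k) * (1 - e k))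
     - q k / (q k + w k) * (q k / (q k + w k)) * (1 - 2 * e k)).
    rewrite -[s in 2 * s]mulr1 -[s ^+ 2]mulr1.
    apply: cvgB; apply: cvgM => //; [exact: cvg_cst| exact: cvgM | exact: cvgM].
  apply/funext => k; have [xc yc xy] := xyc k; rewrite U_leaf_leaf // /e.
  move: (d1 k) (d2 k); move: (q k) (w k) (k.+3%:R : R) => Q W N h1 h2.
  by field; rewrite h1 h2.
Qed.

End Limits.

(** * Separation probabilities on the star *)

Theorem proposition2 (R : realType) :
  (forall (n : nat) (w : R) (c x y : 'I_n),
     (3 <= n)%N -> 0 < w -> x != c -> y != c -> x != y ->
     [/\ (forall q : R, 0 < q ->
            U (star_digraph c w) q c x =
              q * (q + (n%:R - 1) * w) / ((q + w) * (q + n%:R * w))),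
         (forall q : R, 0 < q ->
            U (star_digraph c w) q x y =
              q * (q ^+ 2 + (n%:R + 2) * w * q + 2 * (n%:R - 1) * w ^+ 2)
                / ((q + w) ^+ 2 * (q + n%:R * w))),
         strictly_concave_on `]0, +oo[ (fun q => U (star_digraph c w) q c x)
       & strictly_concave_on `]0, +oo[ (fun q => U (star_digraph c w) q x y)])
  /\
  (forall (alpha beta qbar wbar : R) (c x y : forall k : nat, 'I_k.+3),
     0 < qbar -> 0 < wbar ->
     (forall k : nat, [/\ x k != c k, y k != c k & x k != y k]) ->
     let qseq (n : nat) : R := qbar * n%:R `^ alpha in
     let wseq (n : nat) : R := wbar * n%:R `^ beta in
     (U (star_digraph (c k) (wseq k.+3)) (qseq k.+3) (c k) (x k) @[k --> \oo]
        --> (if beta < alpha then 1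
             else if alpha == beta then qbar / (qbar + wbar)
             else 0 : R))
     /\
     (U (star_digraph (c k) (wseq k.+3)) (qseq k.+3) (x k) (y k) @[k --> \oo]
        --> (if beta < alpha then 1
             else if alpha == beta then
               qbar * (qbar + 2 * wbar) / (qbar + wbar) ^+ 2
             else 0 : R))).
Proof.
split=> [n w c x y n3 w0 xc yc xy|alpha beta qbar wbar c x y qb wb xyc q w].
  split=> [q q0|q q0||].
  - exact: U_center_leaf.
  - exact: U_leaf_leaf.
  - exact: U_center_leaf_concave.
  - exact: U_leaf_leaf_concave.
have [Ucx Uxy] := cvg_U_star qb wb xyc (@cvg_powR_fraction R alpha beta _ _ qb wb).
split; first exact: Ucx.
suff -> : (if beta < alpha then 1 else if alpha == beta then
    qbar * (qbar + 2 * wbar) / (qbar + wbar) ^+ 2 else 0) =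
  let s := if beta < alpha then 1 else
    if alpha == beta then qbar / (qbar + wbar) else 0 in 2 * s - s ^+ 2 :> R.
  exact: Uxy.
rewrite /=; case: ifP => _; first by ring.
case: ifP => _; last by ring.
by field; rewrite lt0r_neq0 ?addr_gt0.
Qed.
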